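(* Let $\mathbf{k}$ be a field with characteristic not equal to $2$. Let $\Gamma$ be a finite simple graph with vertex set $V$ and edge set $E$, in which each vertex $i\in V$ is labeled with a positive integer weight $p_i$; for $j\in E$ let $a_j,b_j$ denote its endpoints. Let $\mathbf{k}\langle x_i,\ i\in V\rangle$ be the free associative (noncommutative) algebra graded by $|x_i|=p_i$, let $I(\Gamma)$ be its two-sided ideal generated by the graded commutators $[x_{a_j},x_{b_j}]$, $j\in E$, and let $$A(\Gamma)=\mathbf{k}\langle x_i,\ i\in V\rangle / I(\Gamma).$$ Then the Hilbert series of the graded algebra $A(\Gamma)$ is the inverse of the clique polynomial of $\Gamma$: $$H_{A(\Gamma)}(z)=\left[c_\Gamma(z)\right]^{-1}.$$
   Context: The graded commutator of homogeneous elements is $[a,b]=ab-(-1)^{|a||b|}ba$; the ideal $I(\Gamma)$ does not depend on the order chosen for the endpoints of each edge. The clique polynomial of the weighted graph $\Gamma$ is $c_\Gamma(z)=\sum_{i\ge 0}\sum_{j\ge 0}(-1)^i c_{i,j}z^j$, where $c_{i,j}$ is the number of complete subgraphs (cliques) of $\Gamma$ with $i$ vertices whose weights sum to $j$; the empty clique is included, so $c_{0,0}=1$. The Hilbert series of a non-negatively graded $\mathbf{k}$-algebra $A=\bigoplus_{n\ge0}A_n$ with finite-dimensional pieces is the formal power series $H_A(z)=\sum_{n\ge 0}(\dim_{\mathbf{k}}A_n)z^n$ with integer coefficients; inverses are taken in the ring of formal power series in $z$ over $\mathbb{Z}$. *)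

(* Defs.v *)
From HB Require Import structures.
From mathcomp Require Import all_boot all_order all_algebra.
From mathcomp Require Import generic_quotient ring_quotient.
From mathcomp Require Import boolp classical_sets.
From mathcomp Require Import finmap.
From mathcomp Require Import monalg.

Set Implicit Arguments.
Unset Strict Implicit.
Unset Printing Implicit Defensive.

Import GRing.Theory.
Local Open Scope ring_scope.

(* The ring R[[z]]; a series is wrapped in a record so that its (Cauchy)      *)
(* product cannot be confused with the pointwise product of functions.       *)

Record fps (R : Type) := FPS { fps_coef : nat -> R }.

Section FpsChoice.
Variable R : choiceType.
HB.instance Definition _ := [isNew for @fps_coef R].
HB.instance Definition _ := [Choice of fps R by <:].
End FpsChoice.

Lemma fpsP (R : Type) (f g : fps R) :
  (forall n, fps_coef f n = fps_coef g n) -> f = g.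
Proof. by case: f g => [f] [g] /= fg; congr FPS; apply/funext. Qed.

Section FpsZmod.
Variable R : zmodType.
Implicit Types f g h : fps R.

Definition fps_zero : fps R := FPS (fun=> 0).
Definition fps_opp f := FPS (fun n => - fps_coef f n).
Definition fps_add f g := FPS (fun n => fps_coef f n + fps_coef g n).

Fact fps_addA : associative fps_add.
Proof. by move=> f g h; apply: fpsP => n /=; rewrite addrA. Qed.
Fact fps_addC : commutative fps_add.
Proof. by move=> f g; apply: fpsP => n /=; rewrite addrC. Qed.
Fact fps_add0 : left_id fps_zero fps_add.
Proof. by move=> f; apply: fpsP => n /=; rewrite add0r. Qed.
Fact fps_addN : left_inverse fps_zero fps_opp fps_add.
Proof. by move=> f; apply: fpsP => n /=; rewrite addNr. Qed.

HB.instance Definition _ :=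
  GRing.isZmodule.Build (fps R) fps_addA fps_addC fps_add0 fps_addN.
End FpsZmod.

Section FpsRing.
Variable R : comNzRingType.
Implicit Types f g h : fps R.

Definition fps_one : fps R := FPS (fun n => (n == 0%N)%:R).
Definition fps_mul f g :=
  FPS (fun n => \sum_(i < n.+1) fps_coef f i * fps_coef g (n - i)).

Definition fps_trunc n f : {poly R} := \poly_(i < n.+1) fps_coef f i.

Lemma coef_fps_trunc n f m : (m <= n)%N -> (fps_trunc n f)`_m = fps_coef f m.
Proof. by move=> le_mn; rewrite coef_poly ltnS le_mn. Qed.

Lemma coef_fps_mul n f g m : (m <= n)%N ->
  fps_coef (fps_mul f g) m = (fps_trunc n f * fps_trunc n g)`_m.
Proof.
move=> le_mn; rewrite coefM; apply: eq_bigr => -[i /= lt_im] _.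
by rewrite !coef_fps_trunc // (leq_trans _ le_mn) // leq_subr.
Qed.

Fact fps_mulA : associative fps_mul.
Proof.
move=> f g h; apply: fpsP => n.
transitivity ((fps_trunc n f * (fps_trunc n g * fps_trunc n h))`_n).
  rewrite coefM; apply: eq_bigr => -[i /= lt_in] _.
  by rewrite coef_fps_trunc // -coef_fps_mul // leq_subr.
rewrite mulrA coefM; apply: eq_bigr => -[i /= lt_in] _.
by rewrite -coef_fps_mul // coef_fps_trunc // leq_subr.
Qed.
Fact fps_mulC : commutative fps_mul.
Proof.
move=> f g; apply: fpsP => n.
by rewrite !(coef_fps_mul _ _ (leqnn n)) mulrC.
Qed.
Fact fps_mul1 : left_id fps_one fps_mul.
Proof.
move=> f; apply: fpsP => n /=; rewrite big_ord_recl /= subn0 mul1r.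
by rewrite big1 ?addr0 // => i _; rewrite mul0r.
Qed.
Fact fps_mulDl : left_distributive fps_mul +%R.
Proof.
move=> f g h; apply: fpsP => n /=; rewrite -big_split /=.
by apply: eq_bigr => i _; rewrite mulrDl.
Qed.
Fact fps_one_neq0 : fps_one != 0.
Proof.
by apply/eqP => /(congr1 (fun f => fps_coef f 0%N))/eqP; rewrite /= oner_eq0.
Qed.

HB.instance Definition _ := GRing.Zmodule_isComNzRing.Build (fps R)
  fps_mulA fps_mulC fps_mul1 fps_mulDl fps_one_neq0.

Lemma fps_coefM f g n :
  fps_coef (f * g) n = \sum_(i < n.+1) fps_coef f i * fps_coef g (n - i).
Proof. by []. Qed.

Lemma fps_coef1 n : fps_coef (1 : fps R) n = (n == 0%N)%:R.
Proof. by []. Qed.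

Definition fps_of_poly (q : {poly R}) : fps R := FPS (fun n => q`_n).
End FpsRing.

Section FpsUnit.
Variable R : comUnitRingType.
Implicit Types f g : fps R.

Definition fps_unit : pred (fps R) :=
  fun f => fps_coef f 0%N \is a GRing.unit.

Fixpoint fps_inv_seq f n : seq R :=
  if n is n'.+1 then
    let s := fps_inv_seq f n' in
    rcons s ((fps_coef f 0%N)^-1 *
      ((n' == 0%N)%:R - \sum_(i < n') s`_i * fps_coef f (n' - i)))
  else [::].

Definition fps_inv f : fps R :=
  if fps_unit f then FPS (fun n => (fps_inv_seq f n.+1)`_n) else f.

Lemma size_fps_inv_seq f n : size (fps_inv_seq f n) = n.
Proof. by elim: n => //= n IHn; rewrite size_rcons IHn. Qed.

Lemma nth_fps_inv_seq f n m : (n < m)%N ->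
  (fps_inv_seq f m)`_n = (fps_inv_seq f n.+1)`_n.
Proof.
elim: m => // m IHm; rewrite ltnS leq_eqVlt => /orP[/eqP-> // | lt_nm].
by rewrite [in LHS]/= nth_rcons size_fps_inv_seq lt_nm IHm.
Qed.

Fact fps_mulVx : {in fps_unit, left_inverse 1 fps_inv *%R}.
Proof.
move=> f Uf; have Uf0 : fps_coef f 0%N \is a GRing.unit by [].
rewrite /fps_inv (_ : fps_unit f) //; apply: fpsP => n.
rewrite fps_coefM fps_coef1.
pose S := \sum_(i < n) (fps_inv_seq f n)`_i * fps_coef f (n - i).
have last_inv : (fps_inv_seq f n.+1)`_n =
    (fps_coef f 0%N)^-1 * ((n == 0%N)%:R - S).
  by rewrite /= nth_rcons size_fps_inv_seq ltnn eqxx.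
rewrite big_ord_recr /fps_coef -/(fps_coef f) subnn last_inv.
rewrite [_^-1 * _ * _]mulrAC mulVr // mul1r.
rewrite (_ : \sum_(i < n) _ = S) /=; first by rewrite addrC subrK.
by apply: eq_bigr => -[i /= lt_in] _; rewrite (nth_fps_inv_seq f lt_in).
Qed.

Fact fps_unitPl f g : g * f = 1 -> fps_unit f.
Proof.
move/(congr1 (fun h => fps_coef h 0%N)).
rewrite fps_coefM big_ord1 fps_coef1 => gf1.
by apply/unitrP; exists (fps_coef g 0%N); rewrite [_ f 0%N * _]mulrC.
Qed.

Fact fps_invr_out : {in [predC fps_unit], fps_inv =1 id}.
Proof. by move=> f /negbTE Uf; rewrite /fps_inv (_ : fps_unit f = false). Qed.

HB.instance Definition _ := GRing.ComNzRing_hasMulInverse.Build (fps R)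
  fps_mulVx fps_unitPl fps_invr_out.
End FpsUnit.

Inductive ideal_gen (R : pzRingType) (G : R -> Prop) : R -> Prop :=
| IdealGen x of G x : ideal_gen G x
| Ideal0 : ideal_gen G 0
| IdealB x y of ideal_gen G x & ideal_gen G y : ideal_gen G (x - y)
| IdealMl a x of ideal_gen G x : ideal_gen G (a * x)
| IdealMr a x of ideal_gen G x : ideal_gen G (x * a).

(* Proper two-sided ideals; ring_quotient only has ring structures on        *)
(* quotients of commutative rings.                                           *)
Record ideal2 (R : pzRingType) := Ideal2 {
  in_ideal2 :> R -> Prop;
  ideal2_0 : in_ideal2 0;
  ideal2B : forall x y, in_ideal2 x -> in_ideal2 y -> in_ideal2 (x - y);
  ideal2Ml : forall a x, in_ideal2 x -> in_ideal2 (a * x);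
  ideal2Mr : forall a x, in_ideal2 x -> in_ideal2 (x * a);
  ideal2_1 : ~ in_ideal2 1
}.

Section IdealPred.
Variables (R : pzRingType) (I : ideal2 R).
Definition ideal2_pred : {pred R} := fun x => `[< I x >].
Fact ideal2_zmod_closed : zmod_closed ideal2_pred.
Proof.
split=> [|x y /asboolP Ix /asboolP Iy]; apply/asboolP; first exact: ideal2_0.
exact: ideal2B.
Qed.
HB.instance Definition _ :=
  GRing.isZmodClosed.Build R ideal2_pred ideal2_zmod_closed.
End IdealPred.

Section QuotientAlgebra.
Variables (k : pzRingType) (F : algType k) (I : ideal2 F).

Definition quo_alg := Quotient.quot (ideal2_pred I).
HB.instance Definition _ := GRing.Zmodule.on quo_alg.

Definition quo_pi (x : F) : quo_alg := (\pi_(Quotient.quot (ideal2_pred I)) x)%qT.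

Lemma quo_piP x y : quo_pi x = quo_pi y <-> I (x - y).
Proof.
rewrite /quo_pi; split=> [xy|Ixy].
  by apply/asboolP; change ((x - y) \in ideal2_pred I);
    rewrite Quotient.idealrBE; apply/eqP.
by apply/eqP; rewrite -Quotient.idealrBE; apply/asboolP.
Qed.

Definition quo_repr (u : quo_alg) : F := repr (u : Quotient.quot (ideal2_pred I)).

Lemma quo_reprK : cancel quo_repr quo_pi.
Proof. by move=> u; rewrite /quo_pi /quo_repr reprK. Qed.

Fact quo_pi_is_zmod_morphism : zmod_morphism quo_pi.
Proof. exact: (@pi_is_zmod_morphism _ _ _ (Quotient.quot (ideal2_pred I))). Qed.
HB.instance Definition _ :=
  GRing.isZmodMorphism.Build F quo_alg quo_pi quo_pi_is_zmod_morphism.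

Definition quo_one : quo_alg := quo_pi 1.
Definition quo_mul (u v : quo_alg) : quo_alg := quo_pi (quo_repr u * quo_repr v).
Definition quo_scale (c : k) (u : quo_alg) : quo_alg := quo_pi (c *: quo_repr u).

Lemma quo_reprP x : I (quo_repr (quo_pi x) - x).
Proof. by apply/quo_piP; rewrite quo_reprK. Qed.

Lemma ideal2D x y : I x -> I y -> I (x + y).
Proof.
move=> Ix Iy; rewrite -[y]opprK; apply: ideal2B => //.
by rewrite -sub0r; apply: ideal2B => //; apply: ideal2_0.
Qed.

Lemma quo_piM x y : quo_pi (x * y) = quo_mul (quo_pi x) (quo_pi y).
Proof.
apply/esym/quo_piP; set x' := quo_repr _; set y' := quo_repr _.
rewrite -(subrK (x' * y) (x' * y')) -addrA -mulrBr -mulrBl.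
by apply: ideal2D; [apply: ideal2Ml | apply: ideal2Mr]; apply: quo_reprP.
Qed.

Lemma quo_piZ c x : quo_pi (c *: x) = quo_scale c (quo_pi x).
Proof.
apply/esym/quo_piP; rewrite -scalerBr -[_ - x]mul1r scalerAl.
by apply: ideal2Ml; apply: quo_reprP.
Qed.

Fact quo_mulA : associative quo_mul.
Proof.
move=> u v w; rewrite -[u]quo_reprK -[v]quo_reprK -[w]quo_reprK.
by rewrite -!quo_piM mulrA.
Qed.
Fact quo_mul1 : left_id quo_one quo_mul.
Proof. by move=> u; rewrite -[u]quo_reprK -quo_piM mul1r. Qed.
Fact quo_mulr1 : right_id quo_one quo_mul.
Proof. by move=> u; rewrite -[u]quo_reprK -quo_piM mulr1. Qed.
Fact quo_mulDl : left_distributive quo_mul +%R.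
Proof.
move=> u v w; rewrite -[u]quo_reprK -[v]quo_reprK -[w]quo_reprK.
by rewrite -raddfD -!quo_piM -raddfD mulrDl.
Qed.
Fact quo_mulDr : right_distributive quo_mul +%R.
Proof.
move=> u v w; rewrite -[u]quo_reprK -[v]quo_reprK -[w]quo_reprK.
by rewrite -raddfD -!quo_piM -raddfD mulrDr.
Qed.
Fact quo_one_neq0 : quo_one != 0.
Proof.
apply/eqP; rewrite -(raddf0 quo_pi) => /quo_piP; rewrite subr0.
exact: ideal2_1.
Qed.
HB.instance Definition _ := GRing.Zmodule_isNzRing.Build quo_alg
  quo_mulA quo_mul1 quo_mulr1 quo_mulDl quo_mulDr quo_one_neq0.

Fact quo_scaleA c d u : quo_scale c (quo_scale d u) = quo_scale (c * d) u.
Proof. by rewrite -[u]quo_reprK -!quo_piZ scalerA. Qed.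
Fact quo_scale1 : left_id 1 quo_scale.
Proof. by move=> u; rewrite -[u]quo_reprK -quo_piZ scale1r. Qed.
Fact quo_scaleDr : right_distributive quo_scale +%R.
Proof.
move=> c u v; rewrite -[u]quo_reprK -[v]quo_reprK.
by rewrite -raddfD -!quo_piZ -raddfD scalerDr.
Qed.
Fact quo_scaleDl u : {morph quo_scale^~ u : c d / c + d}.
Proof.
by move=> c d; rewrite -[u]quo_reprK -!quo_piZ -raddfD scalerDl.
Qed.
HB.instance Definition _ := GRing.Zmodule_isLmodule.Build k quo_alg
  quo_scaleA quo_scale1 quo_scaleDr quo_scaleDl.

Fact quo_scaleAl (c : k) (u v : quo_alg) : c *: (u * v) = (c *: u) * v.
Proof.
rewrite -[u]quo_reprK -[v]quo_reprK.
have piM x y : quo_pi (x * y) = quo_pi x * quo_pi y := quo_piM x y.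
have piZ x : quo_pi (c *: x) = c *: quo_pi x := quo_piZ c x.
by rewrite -piM -!piZ -piM scalerAl.
Qed.
HB.instance Definition _ := GRing.Lmodule_isLalgebra.Build k quo_alg quo_scaleAl.

Fact quo_scaleAr (c : k) (u v : quo_alg) : c *: (u * v) = u * (c *: v).
Proof.
rewrite -[u]quo_reprK -[v]quo_reprK.
have piM x y : quo_pi (x * y) = quo_pi x * quo_pi y := quo_piM x y.
have piZ x : quo_pi (c *: x) = c *: quo_pi x := quo_piZ c x.
by rewrite -piM -!piZ -piM scalerAr.
Qed.
HB.instance Definition _ := GRing.Lalgebra_isAlgebra.Build k quo_alg quo_scaleAr.

Fact quo_pi_is_monoid_morphism : monoid_morphism quo_pi.
Proof. by split=> // x y; rewrite quo_piM. Qed.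
HB.instance Definition _ :=
  GRing.isMonoidMorphism.Build F quo_alg quo_pi quo_pi_is_monoid_morphism.
Fact quo_pi_is_scalable : scalable quo_pi.
Proof. by move=> c x; rewrite quo_piZ. Qed.
HB.instance Definition _ :=
  GRing.isScalable.Build k F quo_alg *:%R quo_pi quo_pi_is_scalable.
End QuotientAlgebra.

Section Dimension.
Variables (k : fieldType) (L : lmodType k).
Implicit Type W : L -> Prop.

Definition has_dim W (d : nat) : Prop :=
  exists e : 'I_d -> L,
    [/\ forall i, W (e i),
        forall c : 'I_d -> k, \sum_i c i *: e i = 0 -> forall i, c i = 0
      & forall w, W w -> exists c : 'I_d -> k, w = \sum_i c i *: e i].

Lemma has_dim_le W d d' : has_dim W d -> has_dim W d' -> (d <= d')%N.
Proof.
move=> [e [We free_e _]] [e' [_ _ gen_e']].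
have /choice[N eN] i := gen_e' _ (We i).
pose M := \matrix_(i < d, j < d') N i j.
suff /eqP <- : row_free M by exact: rank_leq_col.
apply/inj_row_free => v vM; apply/rowP => i; rewrite mxE.
apply: (free_e (fun j => v 0 j)).
under eq_bigr => j _ do rewrite [e j]eN scaler_sumr.
rewrite exchange_big /= big1 // => j _.
under eq_bigr => l _ do rewrite scalerA.
rewrite -scaler_suml; have /rowP/(_ j) := vM; rewrite !mxE => vMj.
rewrite (_ : \sum_l _ = 0) ?scale0r // -[RHS]vMj.
by apply: eq_bigr => l _; rewrite mxE.
Qed.

Lemma has_dim_uniq W d d' : has_dim W d -> has_dim W d' -> d = d'.
Proof.
by move=> Wd Wd'; apply/eqP; rewrite eqn_leq !(@has_dim_le W).
Qed.

(* 0 if W is not a finite-dimensional subspace. *)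
Definition dimk W : nat := xget 0%N [set d | has_dim W d].

Lemma dimkP W d : has_dim W d -> dimk W = d.
Proof.
move=> Wd; rewrite /dimk; case: xgetP => [d' -> /= Wd'|/(_ d)//].
exact: has_dim_uniq Wd' Wd.
Qed.
End Dimension.

Definition hilbert_series (k : fieldType) (A : lmodType k)
  (A_ : nat -> A -> Prop) : fps int := FPS (fun n => (dimk (A_ n))%:Z).

Section FreeAlgebra.
Variables (k : fieldType) (V : finType).

(* The monoid algebra of the free monoid of words on V. *)
Definition freealg := {malg k[{fmonom V}]}.
HB.instance Definition _ := GRing.Lalgebra.on freealg.

Fact freealg_scaleAr (c : k) (f g : freealg) : c *: (f * g) = f * (c *: g).
Proof.
have cf : GRing.comm f (malgC c).
  rewrite /GRing.comm; transitivity (fgmul f (malgC c)); first by [].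
  rewrite fgmulgU -[RHS]/(fgmul (malgC c) f) fgmulUg; apply: eq_bigr => m _.
  by rewrite mulrC mulm1 mul1m.
by rewrite -[c *: g]mul_malgC -[LHS]mul_malgC mulrA -cf -mulrA.
Qed.
HB.instance Definition _ :=
  GRing.Lalgebra_isAlgebra.Build k freealg freealg_scaleAr.

Definition gen (i : V) : freealg := << fmu i >>.

Variable p : V -> nat.

Definition word_weight (w : {fmonom V}) : nat := (\sum_(i <- w) p i)%N.

Definition homogeneous (n : nat) (f : freealg) : Prop :=
  forall w : {fmonom V}, w \in msupp f -> word_weight w = n.
End FreeAlgebra.

Definition gcomm (R : pzRingType) (da db : nat) (a b : R) : R :=
  a * b - (-1) ^+ (da * db) * (b * a).

(* The endpoints of an edge j of the graph (V, E) are a j and b j.           *)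
Section GraphAlgebra.
Variables (k : fieldType) (V : finType) (E : {set {set V}}) (p : V -> nat).
Variables (a b : {set V} -> V).

Definition graph_relator (f : freealg k V) : Prop :=
  exists2 j, j \in E &
    f = gcomm (p (a j)) (p (b j)) (gen k (a j)) (gen k (b j)).

Definition graph_ideal_carrier : freealg k V -> Prop := ideal_gen graph_relator.

Lemma mcoeff1_gen (i : V) : mcoeff mone (gen k i) = 0.
Proof. by rewrite /gen mcoeffU fm1_eq1. Qed.

Fact graph_ideal_proper : ~ graph_ideal_carrier 1.
Proof.
suff I1 f : graph_ideal_carrier f -> mcoeff mone f = 0.
  by move/I1/eqP; rewrite rmorph1 oner_eq0.
elim=> [_ [j _ ->]||g h _ g0 _ h0|c g _ g0|c g _ g0].
- by rewrite /gcomm rmorphB !rmorphM /= !mcoeff1_gen !mulr0 subrr.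
- by rewrite rmorph0.
- by rewrite rmorphB /= g0 h0 subrr.
- by rewrite rmorphM /= g0 mulr0.
- by rewrite rmorphM /= g0 mul0r.
Qed.

Definition graph_ideal : ideal2 (freealg k V) :=
  Ideal2 (Ideal0 _) (@IdealB _ _) (@IdealMl _ _) (@IdealMr _ _)
    graph_ideal_proper.

Definition graph_alg := quo_alg graph_ideal.
HB.instance Definition _ := GRing.Algebra.on graph_alg.

Definition graph_alg_pi : freealg k V -> graph_alg := @quo_pi _ _ graph_ideal.

Definition graph_alg_deg (n : nat) (u : graph_alg) : Prop :=
  exists2 f, homogeneous p n f & u = graph_alg_pi f.
End GraphAlgebra.

Section CliquePolynomial.
Variables (V : finType) (E : {set {set V}}) (p : V -> nat).

Definition is_clique (S : {set V}) : bool :=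
  [forall u in S, forall v in S, (u != v) ==> ([set u; v] \in E)].

Definition clique_count (i j : nat) : nat :=
  #|[set S : {set V} | [&& is_clique S, #|S| == i & (\sum_(v in S) p v)%N == j]]|.

(* A clique has at most #|V| vertices and total weight at most               *)
(* \sum_v p v, so the double sum is over all nonzero terms.                  *)
Definition clique_poly : {poly int} :=
  \sum_(i < #|V|.+1) \sum_(j < (\sum_v p v).+1)
    ((-1) ^+ i * (clique_count i j)%:Z) *: 'X^j.
End CliquePolynomial.

(* Main.v *)
(* Cartier and Foata's argument, with signs. Consider words up to exchanging
   adjacent letters joined by an edge. Multiplying each word by the sign of its
   inversions turns the graded commutators into ordinary commutators, so the
   classes of words of weight n give a basis of the degree n part of A(Gamma).
   For a clique S, left multiplication by S is a bijection from the classes of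
   weight n - wt S to the classes u of weight n in which every letter of S can
   be moved to the front. The letters that can be moved to the front of u form
   a clique, so the alternating sum over its subsets S vanishes unless u is
   empty: this is H * c = 1. *)
Require Import Defs.
From HB Require Import structures.
From mathcomp Require Import all_boot all_order all_algebra.
From mathcomp Require Import finmap monalg ring.

Set Implicit Arguments.
Unset Strict Implicit.
Unset Printing Implicit Defensive.

Import GRing.Theory.
Local Open Scope ring_scope.

(** The product of [f x + 1] over all [x] expands into this sum, as [f] vanishes off [F]; each
    element of [F] contributes a factor -1 + 1 = 0. *)
Lemma sum_subset_sign (R : comNzRingType) (T : finType) (F : {set T}) :
  \sum_(S : {set T} | S \subset F) (-1) ^+ #|S| = (F == set0)%:R :> R.
Proof.
pose f x : R := if x \in F then -1 else 0.
transitivity (\prod_x (f x + 1)).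
  rewrite (@bigA_distr R 0 1 *%R +%R) big_mkcond /=; apply: eq_bigr => S _.
  rewrite -big_mkcond; case: (boolP (S \subset F)) => [/subsetP SF|].
    rewrite (eq_bigr (fun=> -1)) ?prodr_const // => x /SF xF.
    by rewrite /f xF.
  by case/subsetPn=> x xS xF; rewrite (bigD1 x) //= /f (negbTE xF) mul0r.
case: eqVneq => [F0|/set0Pn[x xF]].
  by rewrite big1 // => x _; rewrite /f F0 inE add0r.
by rewrite (bigD1 x) //= /f xF addNr mul0r.
Qed.

(** Several terms may be multiples of the same [e j], so the coefficients are accumulated one term
    at a time. *)
Lemma sum_in_span (R : pzRingType) (L : lmodType R) d (e : 'I_d -> L)
    (I : eqType) (r : seq I) (F : I -> L) :
  {in r, forall i, exists c j, F i = c *: e j} ->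
  exists c, \sum_(i <- r) F i = \sum_j c j *: e j.
Proof.
elim: r => [_|i r IHr rF].
  by exists (fun=> 0); rewrite big_nil big1 // => j _; rewrite scale0r.
have [|c rE] := IHr; first by move=> l lr; apply: rF; rewrite inE lr orbT.
have [c' [j Fi]] := rF i (mem_head i r).
exists (fun l => c' * (l == j)%:R + c l); rewrite big_cons rE Fi.
under [RHS]eq_bigr => l _ do rewrite scalerDl.
rewrite big_split; congr (_ + _).
rewrite (bigD1 j) //= eqxx mulr1 big1 ?addr0 // => l /negbTE ->.
by rewrite mulr0 scale0r.
Qed.

(** * Traces: words up to exchange of adjacent independent letters *)

Section Traces.
Variables (V : finType) (ind : rel V).
Hypotheses (ind_sym : symmetric ind) (ind_irr : irreflexive ind).
Implicit Types (x y : V) (s t u w : seq V).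

(* By Cori and Perrin's projection criterion this is the congruence generated by
   the exchanges of adjacent independent letters; see teq_swap and teq_swaps. *)
Definition teq w w' := [forall x, forall y,
  ind x y || (filter (pred2 x y) w == filter (pred2 x y) w')].

Lemma teqP w w' :
  reflect (forall x y, ~~ ind x y ->
             filter (pred2 x y) w = filter (pred2 x y) w')
          (teq w w').
Proof.
apply: (iffP forallP) => [ww' x y /negbTE xy|ww' x].
  by have /forallP/(_ y) := ww' x; rewrite xy => /eqP.
by apply/forallP => y; case: (boolP (ind x y)) => //= /ww' ->.
Qed.

Lemma teq_refl : reflexive teq.
Proof. by move=> w; apply/teqP. Qed.

Lemma teq_sym : symmetric teq.
Proof.
by move=> w w'; apply/teqP/teqP => ww' x y xy; rewrite ww'.
Qed.

Lemma teq_trans : transitive teq.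
Proof.
move=> v u w /teqP uv /teqP vw; apply/teqP => x y xy.
by rewrite uv // vw.
Qed.

Lemma teq_perm w w' : teq w w' -> perm_eq w w'.
Proof.
move/teqP=> ww'; apply/allP => x _; apply/eqP.
(* The diagonal pair is dependent, and its projection counts the occurrences of [x]. *)
have /(congr1 size) := ww' x x (negbT (ind_irr x)).
rewrite !size_filter (eq_count (a2 := pred1 x)); last first.
  by move=> y /=; rewrite orbb.
by rewrite [RHS](eq_count (a2 := pred1 x)) // => y /=; rewrite orbb.
Qed.

Lemma teq_cons x w w' : teq (x :: w) (x :: w') = teq w w'.
Proof.
apply/teqP/teqP => ww' y z yz; have:= ww' y z yz; rewrite /=; case: ifP => // _.
  by case.
by move->.
Qed.

Lemma teq_catl s w w' : teq (s ++ w) (s ++ w') = teq w w'.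
Proof. by elim: s => //= x s IHs; rewrite teq_cons. Qed.

Lemma teq_swap x y w : ind x y -> teq [:: x, y & w] [:: y, x & w].
Proof.
move=> xy; apply/teqP => a b ab /=; case: ifP => //; case: ifP => //.
move=> /orP[] /eqP yE /orP[] /eqP xE; subst; rewrite ?ind_irr // in xy.
  by rewrite ind_sym xy in ab.
by rewrite xy in ab.
Qed.

(** The letter [x] occurs in [w] and its first occurrence is preceded only by letters independent of
    [x], so exchanges can bring it to the front. *)
Fixpoint initial x w :=
  if w is y :: w' then (x == y) || (ind x y && initial x w') else false.

(** Expressed through projections alone, the property is visibly invariant under [teq]. *)
Lemma initialP x w :
  reflect (forall y, ~~ ind x y -> ohead (filter (pred2 x y) w) = Some x)
          (initial x w).
Proof.
apply: (iffP idP).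
  elim: w => //= z w IHw /orP[/eqP <- y _|/andP[xz xw] y xy].
    by rewrite eqxx.
  case: ifP => [/orP[] /eqP zE|_]; last exact: IHw.
    by rewrite zE ind_irr in xz.
  by rewrite -zE xz in xy.
elim: w => [/(_ x)|z w IHw xw] /=; first by rewrite ind_irr => /(_ isT).
case: eqVneq => //= xz; have xz': ind x z.
  apply: contraT => /xw; rewrite /= eqxx orbT => -[zx].
  by rewrite zx eqxx in xz.
rewrite xz' /=; apply: IHw => y xy; have:= xw y xy; rewrite /=.
case: ifP => // /orP[] /eqP zE; first by rewrite zE eqxx in xz.
by rewrite -zE xz' in xy.
Qed.

Lemma initial_teq x w w' : teq w w' -> initial x w = initial x w'.
Proof.
move/teqP=> ww'; apply/initialP/initialP => xw y xy; have:= xw y xy;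
by rewrite ww'.
Qed.

Lemma initial_ind x y w : initial x w -> initial y w -> x != y -> ind x y.
Proof.
elim: w => //= z w IHw /orP[/eqP-> | /andP[xz xw]] /orP[/eqP-> | /andP[yz yw]].
- by rewrite eqxx.
- by rewrite ind_sym.
- by [].
- exact: IHw.
Qed.

Section TeqInd.
Variable P : seq V -> seq V -> Prop.
Hypotheses (P_refl : forall w, P w w)
  (P_trans : forall u v w, P u v -> P v w -> P u w)
  (P_cons : forall x w w', P w w' -> P (x :: w) (x :: w'))
  (P_swap : forall x y w, ind x y -> P [:: x, y & w] [:: y, x & w]).

(** The first [x] travels to the front by single exchanges. [P] stays abstract because this serves
    both [teq] itself and the arbitrary relation of [teq_swaps]. *)
Lemma initial_rem x w : initial x w -> P (x :: rem x w) w.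
Proof.
elim: w => //= z w IHw; rewrite [z == x]eq_sym.
case: eqVneq => [-> _|_ /= /andP[xz /IHw Pw]]; first exact: P_refl.
exact: P_trans (P_swap _ xz) (P_cons _ Pw).
Qed.
End TeqInd.

Lemma teq_rem x w : initial x w -> teq (x :: rem x w) w.
Proof.
apply: (initial_rem (P := teq)) => [w' | u v w' uv | y u v | y z u].
- exact: teq_refl.
- exact: teq_trans uv.
- by rewrite teq_cons.
- exact: teq_swap.
Qed.

(** Induction on [w]: its head is initial in [w'], so exchanges bring it to the front of [w'], where
    it cancels. *)
Lemma teq_swaps (P : seq V -> seq V -> Prop) :
  (forall w, P w w) ->
  (forall u v w, P u v -> P v w -> P u w) ->
  (forall x w w', P w w' -> P (x :: w) (x :: w')) ->
  (forall x y w, ind x y -> P [:: x, y & w] [:: y, x & w]) ->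
  forall w w', teq w w' -> P w w'.
Proof.
move=> P_refl P_trans P_cons P_swap w; elim: w => [|x w IHw] w' ww'.
  by move/teq_perm: ww'; rewrite perm_sym => /perm_nilP->.
have xw' : initial x w' by rewrite -(initial_teq _ ww') /= eqxx.
apply: P_trans (initial_rem P_refl P_trans P_cons P_swap xw').
by apply/P_cons/IHw; rewrite -(teq_cons x) (teq_trans ww') // teq_sym teq_rem.
Qed.

Definition canon w := choose (teq w) w.

Lemma canonP w : teq w (canon w).
Proof. exact: chooseP (teq_refl w). Qed.

Lemma canon_eq w w' : teq w w' -> canon w = canon w'.
Proof.
move=> ww'; rewrite /canon (@eq_choose _ (teq w) (teq w')); last first.
  by move=> u; apply/idP/idP; apply: teq_trans; rewrite // teq_sym.
by apply: choose_id; rewrite ?teq_refl // teq_sym.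
Qed.

Lemma canonK w : canon (canon w) = canon w.
Proof. by apply/canon_eq; rewrite teq_sym canonP. Qed.

Lemma initial_cat s t x : pairwise ind s -> x \in s -> initial x (s ++ t).
Proof.
elim: s => //= y s IHs /andP[ys s_ind]; rewrite inE; case: eqVneq => //= _ xs.
by rewrite ind_sym (allP ys) //= IHs.
Qed.

(** The letters of [s] are extracted one by one; those still to come are independent of the
    extracted [x], hence differ from it and remain initial in [rem x u]. *)
Lemma initial_factor s u : pairwise ind s -> {in s, forall x, initial x u} ->
  exists t, teq u (s ++ t).
Proof.
elim: s u => [|x s IHs] u /=; first by exists u; apply: teq_refl.
case/andP=> xs s_ind su; have xu := su x (mem_head x s).
have [|t ut] := IHs (rem x u) s_ind.
  move=> y ys; have := su y; rewrite inE ys orbT => /(_ isT).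
  rewrite -(initial_teq _ (teq_rem xu)) /=; have xy := allP xs y ys.
  by case: eqVneq => [yx|_ /andP[]//]; rewrite yx ind_irr in xy.
exists t; rewrite -(teq_cons x) in ut; apply: teq_trans ut.
by rewrite teq_sym teq_rem.
Qed.

(** * Counting normal forms by weight *)

Section Weights.
Variable p : V -> nat.
Hypothesis p_gt0 : forall x, (0 < p x)%N.

Definition weight w := (\sum_(x <- w) p x)%N.

Lemma weight_teq w w' : teq w w' -> weight w = weight w'.
Proof. by move/teq_perm => ww'; apply: perm_big. Qed.

Lemma weight_cat w w' : weight (w ++ w') = (weight w + weight w')%N.
Proof. exact: big_cat. Qed.

Lemma size_le_weight w : (size w <= weight w)%N.
Proof.
elim: w => //= x w IHw; rewrite /weight big_cons -add1n.
by rewrite leq_add // p_gt0.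
Qed.

(** Positive weights bound the length of a word by its weight, so enumerating the words of length at
    most [n] misses nothing. *)
Definition normals (n : nat) : seq (seq V) :=
  [seq bseqval v |
    v <- enum [pred v : n.-bseq V | (canon v == v) && (weight v == n)]].

Lemma normals_uniq n : uniq (normals n).
Proof. by rewrite map_inj_uniq ?enum_uniq //; apply: val_inj. Qed.

Lemma mem_normals n w :
  (w \in normals n) = (canon w == w) && (weight w == n).
Proof.
apply/mapP/idP => [[v]|wn]; first by rewrite mem_enum => ? ->.
have w_n : (size w <= n)%N.
  by case/andP: wn => _ /eqP <-; apply: size_le_weight.
by exists (Bseq w_n) => //; rewrite mem_enum.
Qed.

Lemma canon_normals w : canon w \in normals (weight w).
Proof. by rewrite mem_normals canonK eqxx -(weight_teq (canonP w)) eqxx. Qed.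

Lemma normals_eq n m t t' :
  t \in normals n -> t' \in normals m -> teq t t' -> t = t'.
Proof.
rewrite !mem_normals => /andP[/eqP <- _] /andP[/eqP <- _] tt'.
apply: canon_eq; apply: teq_trans (canonP _) (teq_trans tt' _).
by rewrite teq_sym canonP.
Qed.

(** The map sending [t] to [canon (s ++ t)] is a bijection: injective by left cancellation,
    surjective by [initial_factor]. *)
Lemma size_normals_prefix s m : pairwise ind s ->
  size (normals m) =
  count (fun u => all (initial^~ u) s) (normals (weight s + m)).
Proof.
move=> s_ind; rewrite -size_filter -(size_map (fun t => canon (s ++ t))).
apply/perm_size/uniq_perm.
- rewrite map_inj_in_uniq ?normals_uniq // => t t' tm t'm tt'.
  apply: (normals_eq tm t'm); rewrite -(teq_catl s).
  by apply: teq_trans (canonP _) _; rewrite tt' teq_sym canonP.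
- by rewrite filter_uniq // normals_uniq.
- move=> u; rewrite mem_filter; apply/mapP/andP=> [[t tm ->]|[su un]].
    split; last first.
      have := canon_normals (s ++ t); rewrite weight_cat.
      by move: tm; rewrite mem_normals => /andP[_ /eqP ->].
    by apply/allP => x xs; rewrite -(initial_teq _ (canonP _)) initial_cat.
  have [|t ut] := initial_factor (u := u) s_ind.
    by move=> x xs; apply: (allP su).
  move: un; rewrite mem_normals => /andP[/eqP uE /eqP u_wt].
  exists (canon t).
    have := canon_normals t; congr (_ \in normals _).
    by apply: (@addnI (weight s)); rewrite -weight_cat -(weight_teq ut).
  rewrite -uE; apply: canon_eq; apply: teq_trans ut _.
  by rewrite teq_catl canonP.
Qed.

Lemma weight_initial s u : pairwise ind s -> all (initial^~ u) s ->
  (weight s <= weight u)%N.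
Proof.
move=> s_ind su; have [|t ut] := initial_factor (u := u) s_ind.
  by move=> x xs; apply: (allP su).
by rewrite (weight_teq ut) weight_cat leq_addr.
Qed.

Lemma pairwise_enum (S : {set V}) :
  pairwise ind (enum S) = [forall x in S, forall y in S, (x != y) ==> ind x y].
Proof.
(* Unlike [ind], [r] is reflexive, so its pairwise form on [enum S] is a statement about all pairs;
   the lost condition [x != y] is [uniq]. *)
pose r x y := (x != y) ==> ind x y.
have -> : pairwise ind (enum S) = pairwise r (enum S) && uniq (enum S).
  rewrite uniq_pairwise -pairwise_relI; apply: eq_pairwise => x y /=.
  by rewrite /r; case: eqVneq => [->|_]; rewrite ?ind_irr ?andbF ?andbT.
rewrite enum_uniq andbT pairwise_all2rel; first last.
- by move=> x y; rewrite /r eq_sym ind_sym.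
- by move=> x; rewrite /r eqxx.
apply/allrelP/'forall_in_forall_inP => rS x xS y yS; apply: rS => //.
all: by rewrite ?mem_enum // -mem_enum.
Qed.

Lemma weight_enum (S : {set V}) : weight (enum S) = (\sum_(x in S) p x)%N.
Proof. exact: big_enum. Qed.

(** This is the degree [n] coefficient of H * c = 1, by double counting pairs of a clique [S] and a
    normal form [u] in which all of [S] is initial. *)
Lemma clique_sum n :
  \sum_(S : {set V} | pairwise ind (enum S) && (weight (enum S) <= n)%N)
     (-1) ^+ #|S| * (size (normals (n - weight (enum S))))%:Z = (n == 0%N)%:R.
Proof.
transitivity (\sum_(S : {set V} | pairwise ind (enum S)) \sum_(u <- normals n)
   (if S \subset [set x | initial x u] then (-1) ^+ #|S| else 0 : int)).
  rewrite big_mkcondr; apply: eq_bigr => S S_ind.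
  have SE u : S \subset [set x | initial x u] = all (initial^~ u) (enum S).
    apply/subsetP/allP => uS x; rewrite ?inE.
      by rewrite mem_enum => /uS; rewrite inE.
    by rewrite -mem_enum; apply: uS.
  case: leqP => [S_n|n_S].
    rewrite (size_normals_prefix _ S_ind) subnKC // -natz -sum1_count natr_sum.
    rewrite mulr_sumr big_mkcond; apply: eq_bigr => u _.
    by rewrite SE; case: ifP; rewrite ?mulr1.
  (* A clique heavier than [n] cannot be moved to the front of a word of weight [n]. *)
  rewrite big_seq big1 // => u; rewrite mem_normals => /andP[_ /eqP u_n].
  rewrite SE; case: ifP => // /(weight_initial S_ind).
  by rewrite u_n leqNgt n_S.
rewrite exchange_big /=.
transitivity (\sum_(u <- normals n) ((u == [::])%:R : int)).
  apply: eq_bigr => u _; rewrite -big_mkcondr /=.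
  (* Letters initial in one word are pairwise independent, so the inclusion implies the clique
     condition. *)
  transitivity (\sum_(S : {set V} | S \subset [set x | initial x u])
                  ((-1) ^+ #|S| : int)).
    apply: eq_bigl => S.
    case: (boolP (S \subset _)) => Su; rewrite ?andbF ?andbT //.
    rewrite pairwise_enum; apply/'forall_in_forall_inP => x xS y yS.
    apply/implyP; apply: (@initial_ind _ _ u).
      by have := subsetP Su x xS; rewrite inE.
    by have := subsetP Su y yS; rewrite inE.
  rewrite sum_subset_sign; congr _%:R; congr nat_of_bool.
  (* The head of a nonempty word is initial, so only the empty word has no initial letter. *)
  apply/eqP/eqP => [|->]; last by apply/setP => x; rewrite !inE.
  by case: u => // x u /setP/(_ x); rewrite !inE /= eqxx.
rewrite -natr_sum -big_mkcond sum1_count count_uniq_mem ?normals_uniq //.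
rewrite mem_normals /weight big_nil.
have /teq_perm := canonP [::]; rewrite perm_sym => /perm_nilP->.
by rewrite eqxx [in LHS]eq_sym.
Qed.
End Weights.
End Traces.

(** * The clique polynomial as a sum over cliques *)

Section CliquePoly.
Variables (V : finType) (E : {set {set V}}) (p : V -> nat).

Lemma clique_polyE :
  clique_poly E p =
  \sum_(S | is_clique E S) (-1) ^+ #|S| *: 'X^(\sum_(v in S) p v).
Proof.
have S_lt (S : {set V}) : (#|S| < #|V|.+1)%N by rewrite ltnS max_card.
have w_lt (S : {set V}) : (\sum_(v in S) p v < (\sum_v p v).+1)%N.
  by rewrite ltnS [leqRHS](bigID (mem S)) leq_addr.
rewrite (partition_big (fun S => Ordinal (S_lt S)) xpredT) //=.
apply: eq_bigr => i _.
rewrite (partition_big (fun S => Ordinal (w_lt S)) xpredT) //=.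
apply: eq_bigr => j _.
rewrite (eq_bigr (fun=> (-1) ^+ i *: 'X^j)); last first.
  by move=> S /andP[/andP[_ /eqP <-] /eqP <-].
rewrite sumr_const scalerMnl -mulr_natr natz; congr (_ * Posz _ *: _).
apply: eq_card => S; rewrite inE unfold_in /=.
by rewrite andbA.
Qed.
End CliquePoly.

(** * Koszul signs of words *)

Section Signs.
Variables (R : comNzRingType) (V : finType) (p : V -> nat).
Implicit Types (x y : V) (w : seq V).

Definition head_sign x w : R :=
  \prod_(y <- w | (enum_rank y < enum_rank x)%N) (-1) ^+ (p x * p y).

(* The sign picked up when w is sorted in a graded commutative algebra. *)
Fixpoint word_sign w : R :=
  if w is x :: w' then head_sign x w' * word_sign w' else 1.

Lemma head_sign_perm x w w' : perm_eq w w' -> head_sign x w = head_sign x w'.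
Proof. exact: perm_big. Qed.

Lemma word_sign_sqr w : word_sign w * word_sign w = 1.
Proof.
elim: w => [|x w IHw] /=; first exact: mulr1.
rewrite mulrACA IHw mulr1 /head_sign -big_split big1 // => y _.
by rewrite /= -expr2 sqrr_sign.
Qed.

(** Exactly one of the two orders of distinct [x] and [y] is an inversion; every other pair keeps
    its order. *)
Lemma word_sign_swap u x y w : x != y ->
  word_sign (u ++ [:: x, y & w]) =
  (-1) ^+ (p x * p y) * word_sign (u ++ [:: y, x & w]).
Proof.
move=> xy; elim: u => [|z u IHu] /=; last first.
  rewrite IHu mulrCA; congr (_ * (_ * _)); apply: head_sign_perm.
  by rewrite perm_cat2l (perm_catCA [:: x] [:: y]).
rewrite /head_sign !big_cons.
have : enum_rank x != enum_rank y by rewrite (inj_eq enum_rank_inj).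
rewrite -val_eqE /= neq_ltn [(p y * p x)%N]mulnC.
case: ltngtP => // _ _; first by rewrite !mulrA -expr2 sqrr_sign; ring.
ring.
Qed.
End Signs.

(** * A basis of each graded piece of the graph algebra *)

Section GraphAlgebra.
Variables (k : fieldType) (V : finType) (E : {set {set V}}) (p : V -> nat).
Variables (a b : {set V} -> V).
Hypotheses (simpleE : forall j, j \in E -> #|j| = 2%N)
  (endpoints : forall j, j \in E -> j = [set a j; b j]).
Implicit Types (x y : V) (s t u w : seq V).

Definition adj : rel V := [rel x y | [set x; y] \in E].

Lemma adj_sym : symmetric adj.
Proof. by move=> x y; rewrite /adj /= setUC. Qed.

Lemma adj_irr : irreflexive adj.
Proof. by move=> x; apply/negP => /simpleE; rewrite setUid cards1. Qed.

Lemma adj_neq x y : adj x y -> x != y.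
Proof. by apply: contraTneq => ->; rewrite adj_irr. Qed.

Lemma adj_endpoints j : j \in E -> adj (a j) (b j).
Proof. by move=> jE; rewrite /adj /= -endpoints. Qed.

Lemma is_cliqueE (S : {set V}) : is_clique E S = pairwise adj (enum S).
Proof. by rewrite (pairwise_enum adj_sym adj_irr). Qed.

(* Locked because conversion otherwise unfolds the product of the monoid algebra
   down to finite maps. *)
Definition mono w : freealg k V := locked << FMonom w >>.

Lemma monoE w : mono w = << FMonom w >>.
Proof. by rewrite /mono -lock. Qed.

Lemma genE x : gen k x = mono [:: x].
Proof. by rewrite monoE /gen fmuE. Qed.

Lemma monoM u w : mono u * mono w = mono (u ++ w).
Proof.
by rewrite !monoE malgM_def fgmulUU mulr1 -(fmmulE (FMonom u) (FMonom w)).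
Qed.

Lemma malgUE (c : k) (w : {fmonom V}) :
  << c *g w >> = c *: mono w :> freealg k V.
Proof.
by rewrite monoE fmK; apply/malgP => u; rewrite mcoeffZ !mcoeffU mulr_natr.
Qed.

Lemma freealgE (f : freealg k V) : f = \sum_(w <- msupp f) mcoeff w f *: mono w.
Proof. by rewrite {1}[f]monalgE; apply: eq_bigr => w _; rewrite malgUE. Qed.

(* Twisting the class of w by word_sign w turns the relators into plain
   commutations, so these functionals vanish on the ideal. *)
Definition class_coef t (f : freealg k V) : k :=
  mmap idfun (fun w : {fmonom V} => word_sign k p w * (teq adj w t)%:R) f.

Fact class_coef_is_zmod_morphism t : zmod_morphism (class_coef t).
Proof. exact: mmap_is_additive. Qed.
HB.instance Definition _ t := GRing.isZmodMorphism.Build (freealg k V) k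
  (class_coef t) (class_coef_is_zmod_morphism t).

Lemma class_coefZ t c w :
  class_coef t (c *: mono w) = c * (word_sign k p w * (teq adj w t)%:R).
Proof. by rewrite -[_ *: _](malgUE c (FMonom w)) /class_coef mmapU. Qed.

Lemma class_coef_mul t (f h : freealg k V) s :
  class_coef t (f * mono s * h) =
  \sum_(u <- msupp f) \sum_(w <- msupp h) mcoeff u f * mcoeff w h *
     (word_sign k p (u ++ s ++ w) * (teq adj (u ++ s ++ w) t)%:R).
Proof.
rewrite {1}[f]freealgE [_ * mono s]mulr_suml mulr_suml raddf_sum.
apply: eq_bigr => u _; rewrite {1}[h]freealgE mulr_sumr raddf_sum.
apply: eq_bigr => w _.
by rewrite -!scalerAl -scalerAr scalerA !monoM /= class_coefZ catA.
Qed.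

(** In the bilinear expansion, each exchange preserves the class and changes [word_sign] by exactly
    the sign of the graded commutator. *)
Lemma class_coef_swap t (f h : freealg k V) x y : adj x y ->
  class_coef t (f * mono [:: x; y] * h) =
  (-1) ^+ (p x * p y) * class_coef t (f * mono [:: y; x] * h).
Proof.
move=> xy; rewrite [LHS]class_coef_mul [in RHS]class_coef_mul.
rewrite [RHS]mulr_sumr; apply: eq_bigr => u _.
rewrite [RHS]mulr_sumr; apply: eq_bigr => w _ /=.
rewrite word_sign_swap ?adj_neq //.
have -> : teq adj (u ++ [:: x, y & w]) t = teq adj (u ++ [:: y, x & w]) t.
  have sw : teq adj (u ++ [:: x, y & w]) (u ++ [:: y, x & w]).
    by rewrite teq_catl (teq_swap adj_sym adj_irr).
  by apply/idP/idP; apply: teq_trans; rewrite // teq_sym.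
ring.
Qed.

Lemma class_coef_relator t (f h : freealg k V) r :
  graph_relator E p a b r -> class_coef t (f * r * h) = 0.
Proof.
case=> j jE ->; rewrite /gcomm !genE monoM monoM /=.
have := class_coef_swap t f h (adj_endpoints jE).
move: (mono _) (mono _) => r1 r2.
(* The sign of [gcomm] lives in the free algebra and that of [xy] in [k]; splitting on parity
   matches them. *)
rewrite -signr_odd -(signr_odd (freealg k V)); case: odd => /= xy.
  rewrite expr1 in xy *.
  rewrite mulN1r opprK mulrDr mulrDl [LHS]raddfD /=.
  by rewrite [X in X + _]xy mulN1r addNr.
rewrite expr0 mul1r in xy *.
rewrite mul1r mulrBr mulrBl [LHS]raddfB /=.
by rewrite [X in X - _]xy subrr.
Qed.

Lemma class_coef_ideal t f :
  graph_ideal_carrier E p a b f -> class_coef t f = 0.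
Proof.
(* Multipliers on both sides are carried through the induction to absorb the ideal's own
   multiplications. *)
move=> If; suff H g h : class_coef t (g * f * h) = 0.
  by have := H 1 1; rewrite mul1r mulr1.
elim: If g h =>
  [r rel g h | g h | x y _ IHx _ IHy g h | c x _ IHx g h | c x _ IHx g h].
- exact: class_coef_relator.
- by rewrite mulr0 mul0r raddf0.
- by rewrite mulrBr mulrBl [LHS]raddfB /= [X in X - _]IHx [X in _ - X]IHy subrr.
- by rewrite mulrA; apply: IHx.
- by rewrite mulrA -mulrA; apply: IHx.
Qed.

(** The chosen order of endpoints is immaterial: the sign squares to 1, so each relation can be
    reversed. *)
Lemma endpoints_swap (L : lmodType k) (F : V -> V -> L) :
  (forall j, j \in E ->
     F (a j) (b j) = (-1) ^+ (p (a j) * p (b j)) *: F (b j) (a j)) ->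
  forall x y, adj x y -> F x y = (-1) ^+ (p x * p y) *: F y x.
Proof.
move=> Fab x y xy; have := Fab _ xy; have := endpoints xy.
move: (a _) (b _) => a' b' /setP ab.
have := ab x; have := ab y; have := ab a'; have := ab b'.
rewrite !inE !eqxx ?orbT /= => _ _ /esym yE /esym xE.
have := adj_neq xy; case/orP: xE => /eqP ->; case/orP: yE => /eqP -> //.
- by rewrite eqxx.
- by move=> _ ->; rewrite scalerA mulnC -expr2 sqrr_sign scale1r.
- by rewrite eqxx.
Qed.

Lemma word_sign_teq (A : algType k) (X : seq V -> A) :
  (forall u w, X (u ++ w) = X u * X w) ->
  (forall j, j \in E ->
     X [:: a j; b j] = (-1) ^+ (p (a j) * p (b j)) *: X [:: b j; a j]) ->
  forall c u w, teq adj u w ->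
    c *: X u = (c * (word_sign k p u * word_sign k p w)) *: X w.
Proof.
move=> XM /(endpoints_swap (F := fun x y => X [:: x; y])) X_swap c u w uw.
(* Signed words are constant on classes. Prepending a letter multiplies by its [head_sign], which
   depends only on the letters of the word, hence the [perm_eq]. *)
pose P u w := perm_eq u w /\ word_sign k p u *: X u = word_sign k p w *: X w.
suff [_ e] : P u w.
  rewrite -[X u]scale1r -(word_sign_sqr k p u) -[_ *: X u]scalerA e.
  by rewrite !scalerA mulrA.
apply: (@teq_swaps _ _ adj_sym adj_irr P) uw.
- by [].
- move=> u1 u2 u3 [p12 e12] [p23 e23]; split; first exact: perm_trans p23.
  exact: etrans e23.
- move=> x u1 u2 [p12 e12]; split; first by rewrite perm_cons.
  rewrite /= (head_sign_perm _ _ _ p12) -!scalerA; congr (_ *: _).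
  by rewrite (XM [:: x] u1) (XM [:: x] u2) !scalerAr e12.
move=> x y u1 xy; split; first by rewrite (perm_catCA [:: x] [:: y]).
rewrite (word_sign_swap k p [::] _ (adj_neq xy)) (XM [:: x; y]) X_swap //.
rewrite -scalerAl -XM scalerA /=.
by rewrite mulrAC -expr2 sqrr_sign mul1r.
Qed.

Local Notation pi := (quo_pi (graph_ideal k E p a b)).

Lemma pi_endpoints j : j \in E -> pi (mono [:: a j; b j]) =
  (-1) ^+ (p (a j) * p (b j)) *: pi (mono [:: b j; a j]).
Proof.
move=> jE; rewrite -linearZ; apply/quo_piP.
suff -> : mono [:: a j; b j] -
      (-1) ^+ (p (a j) * p (b j)) *: mono [:: b j; a j] =
    gcomm (p (a j)) (p (b j)) (gen k (a j)) (gen k (b j)).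
  by apply: IdealGen; exists j.
rewrite /gcomm !genE 2!monoM /=; move: (mono _) (mono _) => r1 r2.
rewrite -signr_odd -(signr_odd (freealg k V)); case: odd => /=.
  by rewrite !expr1 mulN1r scaleN1r.
by rewrite !expr0 mul1r scale1r.
Qed.

Lemma pi_teq c u w : teq adj u w ->
  c *: pi (mono u) = (c * (word_sign k p u * word_sign k p w)) *: pi (mono w).
Proof.
apply: (word_sign_teq (X := fun w => pi (mono w))) => [u1 w1 | j].
  by rewrite -monoM; apply: quo_piM.
exact: pi_endpoints.
Qed.

Lemma homogeneous_mono w : homogeneous p (weight p w) (mono w).
Proof. by move=> v; rewrite monoE msuppU1 in_fset1 => /eqP ->. Qed.

(** The images of the normal forms are a basis: the functionals [class_coef] are dual to them up to
    sign, and [pi_teq] reduces every word to its normal form. *)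
Lemma has_dim_graph_alg_deg (p_gt0 : forall x, (0 < p x)%N) n :
  has_dim (@graph_alg_deg k V E p a b n) (size (normals adj p n)).
Proof.
pose e (i : 'I_(size (normals adj p n))) :=
  pi (mono (nth [::] (normals adj p n) i)).
exists e; split.
- move=> i; exists (mono (nth [::] (normals adj p n) i)) => //.
  have: nth [::] (normals adj p n) i \in normals adj p n by apply: mem_nth.
  move: (nth _ _ _) => w; rewrite mem_normals // => /andP[_ /eqP <-].
  exact: homogeneous_mono.
- move=> c ce0 i.
  have /quo_piP : pi (\sum_i c i *: mono (nth [::] (normals adj p n) i)) = pi 0.
    rewrite raddf0 raddf_sum -[RHS]ce0; apply: eq_bigr => j _.
    exact: linearZ.
  (* Distinct normal forms are inequivalent, so this functional isolates [c i] up to a sign. *)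
  rewrite subr0 => /(class_coef_ideal (nth [::] (normals adj p n) i)).
  rewrite raddf_sum (bigD1 i) //= big1 => [|j ji].
    rewrite addr0 class_coefZ teq_refl mulr1 => /eqP.
    rewrite mulf_eq0 => /orP[/eqP//|/eqP w0].
    have := word_sign_sqr k p (nth [::] (normals adj p n) i).
    by rewrite w0 mul0r => /eqP; rewrite eq_sym oner_eq0.
  rewrite class_coefZ; case: (boolP (teq _ _ _)) => [tji|_]; last first.
    by rewrite !mulr0.
  have := normals_eq p_gt0 (mem_nth _ (ltn_ord j)) (mem_nth _ (ltn_ord i)) tji.
  move/eqP; rewrite nth_uniq ?normals_uniq //.
  by move=> /eqP/val_inj ij; rewrite ij eqxx in ji.
- move=> _ [f f_n ->].
  suff : exists c, pi f = \sum_i c i *: e i by [].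
  rewrite [f]freealgE raddf_sum; apply: sum_in_span => w wf.
  have wc := canon_normals adj_irr p_gt0 w.
  rewrite [weight _ _](f_n w wf) -index_mem in wc.
  exists (mcoeff w f * (word_sign k p w * word_sign k p (canon adj w))).
  exists (Ordinal wc).
  have nw : nth [::] (normals adj p n) (Ordinal wc) = canon adj w.
    by rewrite /= nth_index // -index_mem.
  rewrite /e nw; transitivity (mcoeff w f *: pi (mono w)); first exact: quo_piZ.
  exact: pi_teq (canonP adj w).
Qed.
End GraphAlgebra.

Theorem theorem1p1 (k : fieldType) (char_k : 2%N \notin [pchar k])
  (V : finType) (E : {set {set V}}) (simpleE : forall j, j \in E -> #|j| = 2%N)
  (p : V -> nat) (p_gt0 : forall i, (0 < p i)%N)
  (a b : {set V} -> V)
  (endpoints : forall j, j \in E -> j = [set a j; b j]) :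
  hilbert_series (@graph_alg_deg k V E p a b) =
    (fps_of_poly (clique_poly E p))^-1.
Proof.
(* It suffices that the clique series times the Hilbert series is 1, coefficient by coefficient. *)
apply/esym/mulr1_eq/fpsP => n; rewrite fps_coefM fps_coef1 /=.
rewrite -(clique_sum (adj_sym E) (adj_irr simpleE) p_gt0 n).
under eq_bigr => i _.
  rewrite clique_polyE (dimkP (has_dim_graph_alg_deg _ _ _ _ _)) //.
  rewrite coef_sum mulr_suml.
  over.
(* With the sum over cliques outside, [S] contributes only at the index equal to its weight, which
   is in range exactly when it is at most [n]. *)
rewrite exchange_big /= big_mkcondr; apply: eq_big => S.
  by rewrite (is_cliqueE simpleE).
move=> _; rewrite -weight_enum; set m := weight p _.
under eq_bigr => i _ do rewrite coefZ coefXn.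
case: leqP => [m_n|n_m]; last first.
  rewrite big1 // => i _.
  by rewrite (ltn_eqF (leq_trans (ltn_ord i) _)) // mulr0 mul0r.
rewrite (bigD1 (Ordinal (m_n : (m < n.+1)%N))) //= eqxx mulr1.
rewrite big1 ?addr0 // => i.
by rewrite -val_eqE => /negbTE /= ->; rewrite mulr0 mul0r.
Qed.
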